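(* Let $\mathcal{Q}$ be a polynomial ideal. Then $\mathcal{Q}$ is injective if and only if $\mathcal{Q}$ has the strong domination property.
   Context: All Banach spaces are over $\mathbb{K}=\mathbb{R}$ or $\mathbb{C}$. For Banach spaces $E,F$ and $m\in\mathbb{N}$, $\mathcal{L}(E;F)$ is the space of bounded linear operators from $E$ to $F$ and $\mathcal{P}(^mE;F)$ is the space of continuous $m$-homogeneous polynomials from $E$ to $F$. Polynomials of finite type are the finite sums $x\mapsto\sum_i \varphi_i(x)^m y_i$ with $\varphi_i\in E^*$, $y_i\in F$. A polynomial ideal is a subclass $\mathcal{Q}$ of the class of all continuous homogeneous polynomials between Banach spaces such that, for every $m\in\mathbb{N}$ and all Banach spaces $E,F$, the component $\mathcal{Q}(^mE;F):=\mathcal{P}(^mE;F)\cap\mathcal{Q}$ is a linear subspace of $\mathcal{P}(^mE;F)$ containing the polynomials of finite type, and such that $t\circ P\circ u\in\mathcal{Q}(^mE;H)$ whenever $t\in\mathcal{L}(G;H)$, $P\in\mathcal{Q}(^mF;G)$ and $u\in\mathcal{L}(E;F)$. A metric injection is a linear operator $j\colon F\to G$ between Banach spaces with $\|j(y)\|=\|y\|$ for every $y\in F$. A polynomial ideal $\mathcal{Q}$ is injective if $P\in\mathcal{Q}(^mE;F)$ whenever $P\in\mathcal{P}(^mE;F)$ and $j\colon F\to G$ is a metric injection such that $j\circ P\in\mathcal{Q}(^mE;G)$ (for all $m$ and all Banach spaces $E,F,G$). A polynomial ideal $\mathcal{Q}$ has the strong domination property if, for all $m\in\mathbb{N}$ and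 all Banach spaces $E,F,G$, given polynomials $P\in\mathcal{Q}(^mE;F)$ and $Q\in\mathcal{P}(^mE;G)$ for which there is a constant $C\ge 0$ (possibly depending on $E,F,G,P,Q,m$) such that $$\left\|\sum_{i=1}^k\lambda_iQ(x_i)\right\|\le C\cdot\left\|\sum_{i=1}^k\lambda_iP(x_i)\right\|$$ for all $k\in\mathbb{N}$, $x_1,\ldots,x_k\in E$ and $\lambda_1,\ldots,\lambda_k\in\mathbb{K}$, one has $Q\in\mathcal{Q}(^mE;G)$. *)

(* Defs.v *)
From mathcomp Require Import all_boot all_order all_algebra.
From mathcomp Require Import complex.
From mathcomp Require Import all_classical all_reals all_analysis.

Set Implicit Arguments.
Unset Strict Implicit.
Unset Printing Implicit Defensive.

Import GRing.Theory Num.Theory.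
Import numFieldNormedType.Exports.

Local Open Scope classical_set_scope.
Local Open Scope ring_scope.

Inductive real_or_complex : numFieldType -> Prop :=
| real_scalars (R : realType) : real_or_complex R
| complex_scalars (R : realType) : real_or_complex (R[i] : numFieldType).

(* Banach spaces over K are the objects of completeNormedModType K. As in the
   library, norms take values in K; when K is complex, the order of K makes
   nonnegative elements real, so norms and constants bounding them are real. *)

Section Operators.
Variables (K : numFieldType) (E F : normedModType K).

(* Boundedness is stated as in linear_bounded_continuous. *)
Definition bounded_operator (u : {linear E -> F}) : Prop :=
  bounded_near u (nbhs (0 : E)).

Definition metric_injection (j : {linear E -> F}) : Prop :=
  forall y, `|j y| = `|y|.

End Operators.

Section HomogeneousPolynomials.
Variables (K : numFieldType) (m : nat) (E F : normedModType K).

(* dfwith x i u is x with its i-th coordinate replaced by u. *)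
Definition multilinear_map (A : ('I_m -> E) -> F) : Prop :=
  forall (i : 'I_m) (x : 'I_m -> E), linear (fun u : E => A (dfwith x i u)).

Definition homogeneous_polynomial (P : E -> F) : Prop :=
  exists2 A : ('I_m -> E) -> F,
    multilinear_map A & forall x, P x = A (fun=> x).

Definition cont_poly : set (E -> F) :=
  [set P | homogeneous_polynomial P /\ continuous P].

Definition finite_type_poly : set (E -> F) :=
  [set P | exists (n : nat) (phi : 'I_n -> {linear E -> K^o}) (y : 'I_n -> F),
     (forall i, bounded_operator (phi i)) /\
     forall x, P x = \sum_(i < n) ((phi i x : K) ^+ m) *: y i].

End HomogeneousPolynomials.

Arguments cont_poly {K} m E F.
Arguments finite_type_poly {K} m E F.

Definition map_class (K : numFieldType) :=
  forall E F : completeNormedModType K, set (E -> F).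

Definition component (K : numFieldType) (Q : map_class K) (m : nat)
    (E F : completeNormedModType K) : set (E -> F) :=
  cont_poly m E F `&` @Q E F.

Arguments component {K} Q m E F.

(* Degrees are positive integers: degree 0 (constant maps) is excluded. *)
Record polynomial_ideal (K : numFieldType) (Q : map_class K) : Prop := {
  ideal_cont_poly : forall (E F : completeNormedModType K) (P : E -> F),
    @Q E F P -> exists2 m : nat, (0 < m)%N & cont_poly m E F P;
  ideal_finite_type : forall (m : nat) (E F : completeNormedModType K),
    (0 < m)%N -> finite_type_poly m E F `<=` component Q m E F;
  ideal_linear : forall (m : nat) (E F : completeNormedModType K)
      (a : K) (P P' : E -> F),
    (0 < m)%N -> component Q m E F P -> component Q m E F P' ->
    component Q m E F (fun x => a *: P x + P' x);
  ideal_comp : forall (m : nat) (E F G H : completeNormedModType K)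
      (t : {linear G -> H}) (P : F -> G) (u : {linear E -> F}),
    (0 < m)%N -> bounded_operator t -> component Q m F G P ->
    bounded_operator u -> component Q m E H (t \o P \o u)
}.

Definition injective_ideal (K : numFieldType) (Q : map_class K) : Prop :=
  forall (m : nat) (E F G : completeNormedModType K)
      (P : E -> F) (j : {linear F -> G}),
    (0 < m)%N -> cont_poly m E F P -> metric_injection j ->
    component Q m E G (j \o P) -> component Q m E F P.

Definition strong_domination_property (K : numFieldType) (Q : map_class K) :
    Prop :=
  forall (m : nat) (E F G : completeNormedModType K) (P : E -> F) (S : E -> G),
    (0 < m)%N -> component Q m E F P -> cont_poly m E G S ->
    (exists2 C : K, 0 <= C &
       forall (k : nat) (x : 'I_k -> E) (lambda : 'I_k -> K),
         `|\sum_(i < k) lambda i *: S (x i)|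
           <= C * `|\sum_(i < k) lambda i *: P (x i)|) ->
    component Q m E G S.

(* Main.v *)
(* Injectivity gives strong domination by a pushout, with no Hahn-Banach
   extension.  If S is dominated by P, the pairs
   (sum_i l_i P(x_i), sum_i l_i S(x_i)) form a subspace W of F * G on which
   |z| <= C |y|.  The quotient H of F * G by the closure of W, for the norm
   (C + 1)|y| + |z|, is a Banach space; y |-> [(y, 0)] is bounded, and the bound
   on W makes j : z |-> [(0, -z)] a metric injection.  Since (P x, S x) lies in
   W, j \o S factors through P, so j \o S, hence S, belongs to the ideal.
   Conversely j \o P dominates P with constant 1. *)

From HB Require Import structures.
Require Import Defs.
From mathcomp Require Import all_boot all_order all_algebra.
From mathcomp Require Import generic_quotient ring_quotient complex.
From mathcomp Require Import all_classical all_reals all_analysis.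

Set Implicit Arguments.
Unset Strict Implicit.
Unset Printing Implicit Defensive.

Import Order.TTheory GRing.Theory Num.Theory.
Import numFieldNormedType.Exports.

Local Open Scope classical_set_scope.
Local Open Scope ring_scope.

(** * Infima and small powers in the scalar field *)

Lemma real_nonneg_inf (R : realType) (A : set R) :
  A !=set0 -> (forall a, A a -> 0 <= a) ->
  exists g : R, (forall a, A a -> g <= a) /\
    (forall e, 0 < e -> exists2 a, A a & a < g + e).
Proof.
move=> A0 Age; have hA : has_inf A by split => //; exists 0 => a /Age.
exists (inf A); split => [a Aa|e e0]; first exact: ge_inf hA.2 _ Aa.
by have [a] := inf_adherent e0 hA; exists a.
Qed.

(** Norms are [K]-valued, so quotient norms need infima in [K]. Over [R[i]] a nonnegative element
    has zero imaginary part, so the infimum of the real parts serves. *)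
Lemma scalar_nonneg_inf (K : numFieldType) (hK : real_or_complex K)
    (A : set K) :
  A !=set0 -> (forall a, A a -> 0 <= a) ->
  exists g : K, (forall a, A a -> g <= a) /\
    (forall e, 0 < e -> exists2 a, A a & a < g + e).
Proof.
case: hK A => [|] R A A0 Age; first exact: real_nonneg_inf.
have AIm a : A a -> complex.Im a = 0 by move=> /Age /ger0_Im.
have [] := @real_nonneg_inf R (@complex.Re R @` A).
- by case: A0 => a Aa; exists (complex.Re a), a.
- by move=> _ [a /Age + <-]; rewrite lecE => /andP[].
move=> g [gle gadh]; exists (g%:C)%C; split => [a Aa|e].
  by rewrite lecE AIm //= eqxx /=; apply: gle; exists a.
rewrite ltcE => /andP[/eqP/= e0 /gadh [_ [a Aa <-] lta]].
exists a => //; rewrite ltcE (AIm a Aa).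
by case: e e0 lta => er ei /= -> ->; rewrite addr0 eqxx.
Qed.

Lemma real_half_expr_lt (R : realType) (e : R) : 0 < e ->
  \forall n \near \oo, 2^-1 ^+ n < e.
Proof.
move=> e0; have : (2^-1 ^+ n : R) @[n --> \oo] --> (0 : R).
  by apply: cvg_expr; rewrite ger0_norm// invf_lt1// ltr1n.
by move=> /cvgrPdist_lt/(_ _ e0); apply: filterS => n;
  rewrite sub0r normrN ger0_norm// exprn_ge0.
Qed.

Lemma scalar_half_expr_lt (K : numFieldType) (hK : real_or_complex K) (e : K) :
  0 < e -> \forall n \near \oo, 2^-1 ^+ n < e.
Proof.
case: hK e => [|] R e; first exact: real_half_expr_lt.
case: e => er ei; rewrite ltcE => /andP[/eqP/= -> /real_half_expr_lt].
apply: filterS => n ltn.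
have -> : (2^-1 ^+ n : R[i]) = ((2^-1 ^+ n : R)%:C)%C.
  by rewrite rmorphXn /= fmorphV rmorph_nat.
by rewrite ltcR.
Qed.

(* Completeness is phrased by geometrically bounded series because these lift
   term by term from a quotient. *)
Definition geometric_complete (K : numFieldType) (X : lmodType K)
    (p : X -> K) :=
  forall d : nat -> X, (forall n, p (d n) <= 2^-1 ^+ n) ->
  exists x, forall e : K, 0 < e ->
    \forall n \near \oo, p (x - \sum_(0 <= k < n) d k) < e.

(** * Seminorms, and the Banach space obtained by dividing out the kernel *)

Section SeminormTheory.
Variables (K : numFieldType) (X : lmodType K) (p : X -> K).
Hypothesis pD : forall x y, p (x + y) <= p x + p y.
Hypothesis pZ : forall (l : K) x, p (l *: x) = `|l| * p x.

Lemma seminorm0 : p 0 = 0.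
Proof. by rewrite -(scale0r 0) pZ normr0 mul0r. Qed.

Lemma seminormN x : p (- x) = p x.
Proof. by rewrite -scaleN1r pZ normrN1 mul1r. Qed.

Lemma seminorm_ge0 x : 0 <= p x.
Proof.
have := pD x (- x); rewrite subrr seminorm0 seminormN -mulr2n.
by rewrite pmulrn_lge0.
Qed.

Lemma seminormB x y : p (x - y) <= p x + p y.
Proof. by rewrite -[p y]seminormN. Qed.

Lemma seminorm_eq x y : p (x - y) = 0 -> p x = p y.
Proof.
move=> pxy; apply/eqP; rewrite eq_le; apply/andP; split.
  by have := pD (x - y) y; rewrite subrK pxy add0r.
by have := pD (- (x - y)) x; rewrite seminormN pxy add0r opprB subrK.
Qed.

End SeminormTheory.

Section SeminormQuotient.
Variables (K : numFieldType) (X : lmodType K) (p : X -> K).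
Hypothesis pD : forall x y, p (x + y) <= p x + p y.
Hypothesis pZ : forall (l : K) x, p (l *: x) = `|l| * p x.
Hypothesis half_expr_lt :
  forall e : K, 0 < e -> \forall n \near \oo, 2^-1 ^+ n < e.
Hypothesis p_complete : geometric_complete p.

Definition seminorm_ker : {pred X} := [pred x | p x == 0].

Lemma seminorm_ker_zmod : zmod_closed seminorm_ker.
Proof.
split=> [|x y]; rewrite !inE ?(seminorm0 pZ)// => /eqP px /eqP py.
rewrite eq_le (seminorm_ge0 pD pZ) andbT.
by rewrite (le_trans (seminormB pD pZ _ _))// px py addr0.
Qed.

HB.instance Definition _ :=
  GRing.isZmodClosed.Build X seminorm_ker seminorm_ker_zmod.

Definition seminorm_quot := Quotient.quot seminorm_ker.
HB.instance Definition _ := Choice.on seminorm_quot.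
HB.instance Definition _ := GRing.Zmodule.on seminorm_quot.

Definition seminorm_pi (x : X) : seminorm_quot := \pi_seminorm_quot%qT x.

Lemma seminorm_piE x y : (seminorm_pi x = seminorm_pi y) <-> p (x - y) = 0.
Proof.
rewrite /seminorm_pi; split=> [/eqP|pxy]; last apply/eqP.
  by rewrite -Quotient.idealrBE inE => /eqP.
by rewrite -Quotient.idealrBE inE pxy.
Qed.

Lemma seminorm_piK (a : seminorm_quot) : seminorm_pi (repr a) = a.
Proof. exact: reprK. Qed.

Lemma seminorm_piB : {morph seminorm_pi : x y / x - y}.
Proof. exact: raddfB. Qed.

Lemma seminorm_piD : {morph seminorm_pi : x y / x + y}.
Proof. exact: raddfD. Qed.

(** Scaling goes through a chosen representative; [seminorm_piZ] shows that the choice is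
    immaterial. *)
Definition seminorm_scale (l : K) (a : seminorm_quot) : seminorm_quot :=
  seminorm_pi (l *: repr a).

Lemma seminorm_piZ l x :
  seminorm_pi (l *: x) = seminorm_scale l (seminorm_pi x).
Proof.
apply/seminorm_piE; rewrite -scalerBr pZ.
by have /seminorm_piE -> := esym (seminorm_piK (seminorm_pi x)); rewrite mulr0.
Qed.

Fact seminorm_scaleA a b v :
  seminorm_scale a (seminorm_scale b v) = seminorm_scale (a * b) v.
Proof. by rewrite -(seminorm_piK v) -!seminorm_piZ scalerA. Qed.

Fact seminorm_scale1 : left_id 1 seminorm_scale.
Proof. by move=> v; rewrite -(seminorm_piK v) -!seminorm_piZ scale1r. Qed.

Fact seminorm_scaleDr : right_distributive seminorm_scale +%R.
Proof.
move=> a u v; rewrite -(seminorm_piK u) -(seminorm_piK v).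
by rewrite -seminorm_piD -!seminorm_piZ scalerDr seminorm_piD.
Qed.

Fact seminorm_scaleDl v : {morph seminorm_scale^~ v : a b / a + b}.
Proof.
move=> a b; rewrite -(seminorm_piK v).
by rewrite -!seminorm_piZ scalerDl seminorm_piD.
Qed.

HB.instance Definition _ := GRing.Zmodule_isLmodule.Build K seminorm_quot
  seminorm_scaleA seminorm_scale1 seminorm_scaleDr seminorm_scaleDl.

Fact seminorm_pi_linear : linear seminorm_pi.
Proof. by move=> l x y; rewrite seminorm_piD seminorm_piZ. Qed.

HB.instance Definition _ :=
  GRing.isLinear.Build K X seminorm_quot *:%R seminorm_pi seminorm_pi_linear.

(** [p] is constant on cosets of its kernel, so no infimum over the coset is taken. *)
Definition quot_norm (a : seminorm_quot) : K := p (repr a).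

Lemma quot_norm_pi x : quot_norm (seminorm_pi x) = p x.
Proof.
by apply: (seminorm_eq pD pZ); apply/seminorm_piE; rewrite seminorm_piK.
Qed.

Fact ler_quot_normD a b : quot_norm (a + b) <= quot_norm a + quot_norm b.
Proof.
by rewrite -(seminorm_piK a) -(seminorm_piK b) -seminorm_piD !quot_norm_pi.
Qed.

Fact quot_normZ l a : quot_norm (l *: a) = `|l| * quot_norm a.
Proof. by rewrite -(seminorm_piK a) -linearZ !quot_norm_pi. Qed.

Fact quot_norm0_eq0 a : quot_norm a = 0 -> a = 0.
Proof.
rewrite -(seminorm_piK a) quot_norm_pi -(linear0 seminorm_pi) => pa.
by apply/seminorm_piE; rewrite subr0.
Qed.

HB.instance Definition _ := Lmodule_isNormed.Build K seminorm_quot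
  ler_quot_normD quot_normZ quot_norm0_eq0.

Lemma norm_seminorm_pi x : `|seminorm_pi x| = p x.
Proof. exact: quot_norm_pi. Qed.

(** A Cauchy filter contains balls of geometric radii. Their centres have geometrically small
    increments, which lift to a series in [X] that [p_complete] sums. *)
Lemma seminorm_quot_complete (F : set_system seminorm_quot) :
  ProperFilter F -> cauchy F -> cvg F.
Proof.
move=> FF /cauchyP Fc.
have /choice[a Fa] : forall n, exists x, F (ball x (2^-1 ^+ n.+1 : K)).
  by move=> n; apply: Fc; rewrite exprn_gt0.
(* Two members of a proper filter meet; the radii start at exponent [n.+1] so that two of them add
   up to at most [2^-1 ^+ n]. *)
have aS n : `|a n.+1 - a n| <= 2^-1 ^+ n.
  have [z [z1 z2]] := filter_ex (filterI (Fa n.+1) (Fa n)).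
  rewrite -ball_normE /= in z1; rewrite -ball_normE /= distrC in z2.
  apply: le_trans (ler_distD z _ _) _.
  apply: le_trans (lerD (ltW z1) (ltW z2)) _.
  rewrite (@le_trans _ _ (2^-1 ^+ n.+1 + 2^-1 ^+ n.+1))//.
    rewrite lerD2r [leLHS]exprS ler_piMl ?exprn_ge0//.
    by rewrite invf_le1// ler1n.
  by rewrite exprS -mulrDl -div1r -splitr mul1r.
pose d n := repr (a n.+1) - repr (a n).
have [n|x xlim] := p_complete (d := d).
  by rewrite -norm_seminorm_pi seminorm_piB !seminorm_piK.
(* The lifted series telescopes, so its sum is only the displacement from [repr (a 0)]. *)
apply/cvg_ex; exists (seminorm_pi (repr (a 0) + x)).
apply/fcvgrPdist_lt => e e0; have e20 : 0 < e / 2 by rewrite divr_gt0.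
near \oo => n.
have an : ball (a n) (e / 2) `<=` ball (seminorm_pi (repr (a 0) + x)) e.
  move=> z; rewrite -!ball_normE /= => az.
  rewrite (le_lt_trans (ler_distD (a n) _ _))// [ltRHS]splitr ltrD//.
  have -> : a n = seminorm_pi (repr (a 0) + \sum_(0 <= k < n) d k).
    by rewrite telescope_sumr// subrKC seminorm_piK.
  rewrite -seminorm_piB norm_seminorm_pi opprD addrACA subrr add0r.
  by near: n; exact: xlim.
have Fn : F (ball (a n) (e / 2)).
  apply: filterS (Fa n); apply: le_ball; rewrite ltW// exprS.
  rewrite (@le_lt_trans _ _ (2^-1 ^+ n))//.
    by rewrite ler_piMl ?exprn_ge0// invf_le1// ler1n.
  by near: n; exact: half_expr_lt.
by apply: filterS Fn => z /an; rewrite -ball_normE.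
Unshelve. all: by end_near. Qed.

HB.instance Definition _ :=
  Uniform_isComplete.Build seminorm_quot seminorm_quot_complete.

Lemma banach_seminorm_quotient :
  exists (H : completeNormedModType K) (f : {linear X -> H}),
    forall x, `|f x| = p x.
Proof.
exists seminorm_quot, seminorm_pi; exact: norm_seminorm_pi.
Qed.

End SeminormQuotient.

(** * The distance seminorm to a subspace *)

Section InfSeminorm.
Variables (K : numFieldType) (X : lmodType K) (q : X -> K) (W : set X).
Hypothesis hK : real_or_complex K.
Hypothesis qD : forall x y, q (x + y) <= q x + q y.
Hypothesis qZ : forall (l : K) x, q (l *: x) = `|l| * q x.
Hypothesis W0 : W 0.
Hypothesis W_linear : forall (l : K) u v, W u -> W v -> W (l *: u + v).

Let WZ (l : K) u : W u -> W (l *: u).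
Proof. by move=> Wu; rewrite -[_ *: _]addr0; exact: W_linear. Qed.

(** [p x] is the [q]-distance from [x] to [W]. Its kernel is the [q]-closure of [W], so dividing by
    the kernel divides by that closure without constructing it. *)
Lemma inf_seminorm : exists p : X -> K,
  [/\ forall x y, p (x + y) <= p x + p y,
      forall (l : K) x, p (l *: x) = `|l| * p x,
      forall x w, W w -> p x <= q (x - w)
    & forall x e, 0 < e -> exists2 w, W w & q (x - w) < p x + e].
Proof.
have /choice[p pP] : forall x, exists g : K,
    (forall a, [set q (x - w) | w in W] a -> g <= a) /\
    (forall e, 0 < e -> exists2 a, [set q (x - w) | w in W] a & a < g + e).
  move=> x; apply: (scalar_nonneg_inf hK); first by exists (q (x - 0)), 0.
  by move=> _ [w _ <-]; exact: (seminorm_ge0 qD qZ).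
have p_le x w : W w -> p x <= q (x - w).
  by move=> Ww; apply: (pP x).1; exists w.
have p_adh x e : 0 < e -> exists2 w, W w & q (x - w) < p x + e.
  by move=> /((pP x).2 _)[_ [w Ww <-]]; exists w.
have pZ_le l x : p (l *: x) <= `|l| * p x.
  (* Dividing the slack by [|l| + 1] instead of [|l|] covers [l = 0]. *)
  apply/ler_addgt0Pr => e e0; have l1 : 0 < `|l| + 1 by rewrite ltr_wpDl.
  have [w Ww qw] := p_adh x (e / (`|l| + 1)) (divr_gt0 e0 l1).
  apply: le_trans (p_le _ _ (WZ l Ww)) _; rewrite -scalerBr qZ.
  apply: le_trans (ler_wpM2l (normr_ge0 l) (ltW qw)) _.
  rewrite mulrDr lerD2l mulrCA ler_piMr ?ltW//.
  by rewrite ltr_pdivrMr// mul1r ltrDl.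
exists p; split=> // [x y|l x].
  apply/ler_addgt0Pr => e e0; have e20 : 0 < e / 2 by rewrite divr_gt0.
  have [u Wu qu] := p_adh x _ e20; have [v Wv qv] := p_adh y _ e20.
  have Wuv : W (u + v) by rewrite -[u]scale1r; exact: W_linear.
  apply: le_trans (p_le _ _ Wuv) _; rewrite opprD addrACA.
  apply: le_trans (qD _ _) _; apply: le_trans (lerD (ltW qu) (ltW qv)) _.
  by rewrite addrACA -splitr.
apply/eqP; rewrite eq_le pZ_le /=.
have [->|l0] := eqVneq l 0.
  rewrite normr0 mul0r scale0r; apply/ler_addgt0Pr => e e0.
  have [w Ww qw] := p_adh 0 _ e0; apply: le_trans (ltW qw).
  exact: (seminorm_ge0 qD qZ).
(* The reverse inequality is [pZ_le] for the scalar [l^-1] and the vector [l *: x]. *)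
rewrite -ler_pdivlMl ?normr_gt0// -normfV.
by rewrite -{1}[x](scalerK l0); exact: pZ_le.
Qed.

(** Each term is corrected by an element of [W] to make it [q]-small. The corrections sum to an
    element of [W], which [p] ignores. *)
Lemma inf_geometric_complete (p : X -> K) :
  (forall x w, W w -> p x <= q (x - w)) ->
  (forall x e, 0 < e -> exists2 w, W w & q (x - w) < p x + e) ->
  geometric_complete q -> geometric_complete p.
Proof.
move=> p_le p_adh qc d pd.
have e0 n : 0 < (2^-1 ^+ n : K) by rewrite exprn_gt0.
have /choice[w wP] : forall n, exists w,
    W w /\ q (d n - w) < p (d n) + 2^-1 ^+ n.
  by move=> n; have [w Ww qw] := p_adh (d n) _ (e0 n); exists w.
(* The corrected terms are only below [2 * 2^-1 ^+ n], hence the halving here and the doubled limit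
   below. *)
have [n|x xP] := qc (fun n => 2^-1 *: (d n - w n)).
  rewrite qZ ger0_norm// ler_pdivrMl// mulr_natl mulr2n.
  by rewrite (le_trans (ltW (wP n).2))// lerD2r.
exists (2 *: x) => e epos; have e20 : 0 < e / 2 by rewrite divr_gt0.
apply: filterS (xP _ e20) => n qx.
have Ws : W (- \sum_(0 <= k < n) w k).
  rewrite -scaleN1r; apply: WZ; elim/big_ind: _ => // [u v Wu Wv|k _].
    by rewrite -[u]scale1r; exact: W_linear.
  exact: (wP k).1.
apply: le_lt_trans (p_le _ _ Ws) _.
rewrite -scaler_sumr in qx.
have -> : 2 *: x - \sum_(0 <= k < n) d k - - \sum_(0 <= k < n) w k =
    2 *: (x - 2^-1 *: \sum_(0 <= k < n) (d k - w k)).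
  rewrite scalerBr scalerA mulfV ?pnatr_eq0// scale1r sumrB opprB opprK.
  by rewrite -addrA [- _ + _]addrC.
by rewrite qZ ger0_norm// mulrC -ltr_pdivlMr.
Qed.

End InfSeminorm.

(** * Geometric series in Banach spaces and the pushout *)

Lemma banach_geometric_complete (K : numFieldType) (hK : real_or_complex K)
  (F : completeNormedModType K) : geometric_complete (fun x : F => `|x|).
Proof.
move=> d dP.
(* The subtracted term makes the bound the exact value of the geometric sum, so that the induction
   closes. *)
have tail m k :
    `|\sum_(m <= i < m + k) d i| <= 2 * (2^-1 ^+ m - 2^-1 ^+ (m + k)).
  elim: k => [|k ih]; first by rewrite addn0 big_geq// normr0 subrr mulr0.
  rewrite addnS big_nat_recr ?leq_addr//=.
  apply: le_trans (ler_normD _ _) _; apply: le_trans (lerD ih (dP _)) _.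
  rewrite [in leRHS]exprS !mulrBr mulrA mulfV ?pnatr_eq0// mul1r.
  by rewrite -addrA lerD2l mulr_natl mulr2n opprD -addrA addNr addr0.
have /cvg_ex[x xP] : cvg (series d @ \oo).
  apply/cauchy_cvgP/cauchy_seriesP => e e0.
  have [N _ NP] := scalar_half_expr_lt hK (divr_gt0 e0 (ltr0n K 2)).
  near=> n => /=.
  have [mn|nm] := leqP n.1 n.2; last by rewrite big_geq ?normr0// ltnW.
  rewrite -(subnKC mn); apply: le_lt_trans (tail _ _) _.
  rewrite mulrC -ltr_pdivlMr//; apply: le_lt_trans (NP n.1 _).
    by rewrite gerBl ?exprn_ge0.
  rewrite /=; near: n; exists ([set n | N <= n]%N, setT) => /=.
    by split=> //; exists N.
  by case=> u v [].
exists x => e e0; move/cvgrPdist_lt : xP => /(_ _ e0).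
by apply: filterS.
Unshelve. all: by end_near. Qed.

Lemma banach_pushout (K : numFieldType) (hK : real_or_complex K)
    (F G : completeNormedModType K) (W : set (F * G)%type) (C : K) :
  0 <= C -> W 0 ->
  (forall (l : K) u v, W u -> W v -> W (l *: u + v)) ->
  (forall w, W w -> `|w.2| <= C * `|w.1|) ->
  exists (H : completeNormedModType K)
    (t : {linear F -> H}) (j : {linear G -> H}),
    [/\ bounded_operator t, metric_injection j
      & forall w, W w -> t w.1 = j w.2].
Proof.
move=> C0 W0 Wl WC; have D0 : 0 < C + 1 by rewrite ltr_wpDl.
(* The weight [C + 1] is at least 1, so [q] controls both coordinates even when [C = 0]. *)
pose q (x : (F * G)%type) : K := (C + 1) * `|x.1| + `|x.2|.
have qD x y : q (x + y) <= q x + q y.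
  by rewrite /q addrACA -mulrDr lerD ?ler_normD// ler_pM2l// ler_normD.
have qZ (l : K) x : q (l *: x) = `|l| * q x.
  by rewrite /q !normrZ mulrCA mulrDr.
have q_complete : geometric_complete q.
  move=> d dq.
  have d1 n : `|(d n).1| <= 2^-1 ^+ n.
    apply: le_trans (dq n); rewrite /q -[leLHS]addr0 lerD//.
    by rewrite mulrDl mul1r lerDr mulr_ge0.
  have d2 n : `|(d n).2| <= 2^-1 ^+ n.
    by apply: le_trans (dq n); rewrite /q lerDr mulr_ge0// ltW.
  have [f fP] := banach_geometric_complete hK d1.
  have [g gP] := banach_geometric_complete hK d2.
  exists (f, g) => e e0; have e20 : 0 < e / 2 by rewrite divr_gt0.
  have f_near := fP _ (divr_gt0 e20 D0); have g_near := gP _ e20.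
  apply: filterS2 f_near g_near => n fn gn.
  have -> : (f, g) - \sum_(0 <= k < n) d k =
      (f - \sum_(0 <= k < n) (d k).1, g - \sum_(0 <= k < n) (d k).2).
    rewrite -(raddf_sum fst) -(raddf_sum snd). by case: (\sum_(0 <= k < n) d k).
  rewrite /q /= [ltRHS]splitr; apply: ltrD => //.
  by rewrite mulrC -ltr_pdivlMr.
have [p [pD pZ p_le p_adh]] := inf_seminorm hK qD qZ W0 Wl.
have [H [f pf]] := banach_seminorm_quotient pD pZ (scalar_half_expr_lt hK)
  (inf_geometric_complete qZ W0 Wl p_le p_adh q_complete).
have tl : linear (fun y : F => f (y, 0)).
  by move=> l x y; rewrite -linearP; congr (f (_, _)); rewrite /= scaler0 addr0.
have jl : linear (fun z : G => f (0, - z)).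
  move=> l x y; rewrite -linearP; congr (f (_, _)) => /=.
    by rewrite scaler0 addr0.
  by rewrite opprD scalerN.
pose t : {linear F -> H} :=
  HB.pack (fun y : F => f (y, 0)) (GRing.isLinear.Build _ _ _ _ _ tl).
pose j : {linear G -> H} :=
  HB.pack (fun z : G => f (0, - z)) (GRing.isLinear.Build _ _ _ _ _ jl).
exists H, t, j; split.
(* Comparing with [0] in [W] shows that every [r] above [C + 1] bounds [t]. *)
- apply/linear_boundedP; near=> r => x; rewrite /t /= pf.
  apply: le_trans (p_le _ _ W0) _.
  rewrite /q subr0 /= normr0 addr0 ler_wpM2r//.
  by near: r; apply: nbhs_pinfty_ge; rewrite realE ltW.
- move=> z; rewrite /j /= pf; apply/eqP; rewrite eq_le; apply/andP; split.
    apply: le_trans (p_le _ _ W0) _.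
    by rewrite /q subr0 /= normr0 mulr0 add0r normrN.
  (* For [w] in [W], [|z| <= |z + w.2| + |w.2|] and [|w.2| <= C * |w.1|], so [q ((0, - z) - w)] is
     at least [|z|]. *)
  apply/ler_addgt0Pr => e e0; have [w Ww qw] := p_adh (0, - z) e e0.
  apply: le_trans (ltW qw); rewrite /q /= sub0r normrN.
  have -> : - z - w.2 = - (z + w.2) by rewrite opprD.
  have := ler_normB (z + w.2) w.2; rewrite addrK normrN => /le_trans; apply.
  rewrite addrC lerD2r; apply: le_trans (WC _ Ww) _.
  by rewrite mulrDl mul1r lerDl.
- move=> w Ww; apply/eqP; rewrite -subr_eq0 -normr_eq0 /t /j /= -linearB pf.
  (* The sign in [j] makes this difference [w] itself, which [p] kills. *)
  have -> : (w.1, 0) - (0, - w.2) = w :> (F * G)%type.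
    by case: w {Ww} => y z; congr (_, _); rewrite /= ?subr0// opprK add0r.
  rewrite eq_le (seminorm_ge0 pD pZ) andbT; apply: le_trans (p_le _ _ Ww) _.
  by rewrite subrr (seminorm0 qZ).
Unshelve. all: by end_near. Qed.

(** * Injectivity and strong domination *)

Theorem theorem3p4 (K : numFieldType) (hK : real_or_complex K)
    (Q : map_class K) (hQ : polynomial_ideal Q) :
  injective_ideal Q <-> strong_domination_property Q.
Proof.
split=> [inj m E F G P S m0 QP cS [C C0 dom]|dom m E F G P j m0 cP jm QjP].
  (* Linear combinations are indexed by lists of coefficient-point pairs, so that adding two of them
     is concatenation. *)
  have lincomb_cat (V : lmodType K) (f : E -> V) l r s :
      \sum_(a <- [seq (l * a.1, a.2) | a <- r] ++ s) a.1 *: f a.2 =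
      l *: (\sum_(a <- r) a.1 *: f a.2) + \sum_(a <- s) a.1 *: f a.2.
    rewrite big_cat big_map scaler_sumr; congr (_ + _).
    by apply: eq_bigr => a _; rewrite scalerA.
  pose W := [set w : (F * G)%type | exists s : seq (K * E),
    w = (\sum_(a <- s) a.1 *: P a.2, \sum_(a <- s) a.1 *: S a.2)].
  have [|l _ _ [r ->] [s ->]|w [s ->]/=|H [t [j [tb jm tj]]]] :=
      @banach_pushout K hK F G W C C0.
  - by exists [::]; rewrite !big_nil.
  - exists ([seq (l * a.1, a.2) | a <- r] ++ s).
    by rewrite !lincomb_cat.
  (* Indexing the list by ordinals recovers the families in the domination hypothesis. *)
  - rewrite !(big_tnth _ _ s).
    exact: (dom _ (fun i => (tnth _ i).2) (fun i => (tnth _ i).1)).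
  - apply: (inj _ _ _ _ _ j) => //.
    have -> : j \o S = t \o P \o idfun.
      apply/funext => x /=.
      have := tj (P x, S x); rewrite /= => <- //.
      by exists [:: (1, x)]; rewrite !big_seq1 !scale1r.
    apply: (ideal_comp hQ) => //.
    by apply/linear_bounded_continuous => x; exact: cvg_id.
(* By linearity and isometry of [j], combinations of values of [P] and of [j \o P] have equal
   norms. *)
apply: (dom _ _ _ _ _ _ m0 QjP cP); exists 1 => // k x l.
rewrite mul1r -jm raddf_sum /=.
by under eq_bigr do rewrite linearZ.
Qed.
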